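(* Let $\phi_1,\phi\in C^2(\mathbb R^d)$ have bounded second derivatives, with $\phi_1$ even, and set $$\mathcal V(\mu)=\frac12\int_{\mathbb R^d}(\phi_1*\mu)(q)\,\mu(dq)+\int_{\mathbb R^d}\phi(q)\,\mu(dq),\qquad\mu\in\mathcal P_2(\mathbb R^d).$$ Assume $\lambda>0$, $\lambda_1\in(-\lambda/2,\lambda/2)$, $\phi$ is $\lambda$-convex and $\phi_1$ is $\lambda_1$-convex. Then: (i) $\mathcal V$ is displacement $\kappa$-convex, hence displacement convex, where $\kappa:=\lambda-2|\lambda_1|>0$. (ii) If we further assume that $\phi_1$ is nonnegative, $\phi_1\equiv1$ on the unit ball, and $\phi_1\equiv0$ outside the ball of radius $2$ centered at the origin, then $\mathcal V$ fails to be convex in the classical sense.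
   Context: $\mathcal P_2(\mathbb R^d)$ is the set of Borel probability measures on $\mathbb R^d$ with finite second moment, with the Wasserstein distance $W_2$. A function $\phi$ on $\mathbb R^d$ is $\lambda$-convex if $\phi-\frac\lambda2|\cdot|^2$ is convex. $\mathcal V$ is displacement $\kappa$-convex if for every constant speed $W_2$-geodesic $(\mu_t)_{t\in[0,1]}$, $\mathcal V(\mu_t)\le(1-t)\mathcal V(\mu_0)+t\mathcal V(\mu_1)-\frac\kappa2t(1-t)W_2^2(\mu_0,\mu_1)$ for all $t\in[0,1]$ (displacement convex when $\kappa=0$). $\mathcal V$ is convex in the classical sense if $\mathcal V((1-t)\mu_0+t\mu_1)\le(1-t)\mathcal V(\mu_0)+t\mathcal V(\mu_1)$ for all $\mu_0,\mu_1\in\mathcal P_2(\mathbb R^d)$, $t\in[0,1]$. *)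

(* Defs.v *)
From HB Require Import structures.
From mathcomp Require Import all_boot all_order all_algebra.
From mathcomp Require Import all_classical all_reals all_analysis.
From mathcomp Require Import measurable_realfun.

Set Implicit Arguments.
Unset Strict Implicit.
Unset Printing Implicit Defensive.

Import Order.TTheory GRing.Theory Num.Theory.
Import numFieldNormedType.Exports.

Local Open Scope classical_set_scope.
Local Open Scope ring_scope.

(* R^d is 'rV[R]_d, with the Borel sigma-algebra. *)
HB.instance Definition _ (R : realType) (m n : nat) :=
  @isMeasurable.Build default_measure_display 'M[R]_(m, n)
    <<s @open 'M[R]_(m, n) >>
    (@sigma_algebra0 _ setT _) (@sigma_algebraC _ _)
    (@sigma_algebra_bigcup _ setT _).

Section Euclidean.
Context {R : realType} {d : nat}.
Implicit Types (f : 'rV[R]_d -> R) (x : 'rV[R]_d).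

(* The library norm `|x| on 'rV[R]_d is the sup norm, hence this definition. *)
Definition enorm x : R := Num.sqrt (\sum_(i < d) x 0 i ^+ 2).

Definition partial (i : 'I_d) f : 'rV[R]_d -> R := 'D_(delta_mx 0 i) f.

Definition has_partials f :=
  forall (i : 'I_d) x, derivable f x (delta_mx 0 i).

Definition class_C2 f :=
  [/\ continuous f,
      has_partials f,
      forall i, continuous (partial i f),
      forall i, has_partials (partial i f) &
      forall i j, continuous (partial j (partial i f))].

Definition bounded_second_derivatives f :=
  exists M : R, forall i j x, `|partial j (partial i f) x| <= M.

Definition semiconvex (l : R) f :=
  convex_function [set: 'rV[R]_d] (fun x => f x - l / 2 * enorm x ^+ 2).

End Euclidean.

Section Wasserstein.
Context {R : realType} {d : nat}.
Implicit Types mu nu : probability 'rV[R]_d R.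

Definition finite_second_moment mu :=
  (\int[mu]_x (enorm x ^+ 2)%:E < +oo)%E.

Definition coupling mu nu (g : probability ('rV[R]_d * 'rV[R]_d)%type R) :=
  forall A, measurable A ->
    pushforward g fst A = mu A /\ pushforward g snd A = nu A.

(* The infimum is finite when mu and nu have finite second moments (consider
   the product coupling), so that fine is harmless. *)
Definition W2 mu nu : R :=
  Num.sqrt (fine (ereal_inf
    [set (\int[g]_z (enorm (z.1 - z.2) ^+ 2)%:E)%E | g in coupling mu nu])).

End Wasserstein.

Record P2 (R : realType) (d : nat) := MkP2 {
  P2_probability :> probability 'rV[R]_d R ;
  P2_moment : finite_second_moment P2_probability }.

Section mixture.
Context {R : realType} {d : nat}.
Variables (t : {i01 R}) (mu0 mu1 : probability 'rV[R]_d R).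

Definition mixture : set 'rV[R]_d -> \bar R :=
  measure_add (mscale (1 - t%:num)%:nng mu0) (mscale t%:num%:nng mu1).

HB.instance Definition _ := Measure.on mixture.

Let mixture_setT : mixture setT = 1%E.
Proof.
have scaleT (r : {nonneg R}) (mu : probability 'rV[R]_d R) :
    mscale r mu setT = r%:num%:E.
  by rewrite -[RHS]mule1 -(probability_setT mu).
rewrite /mixture measure_addE.
apply: etrans (congr2 _ (scaleT _ _) (scaleT _ _)) _.
by rewrite -EFinD subrK.
Qed.

HB.instance Definition _ :=
  Measure_isProbability.Build _ _ _ mixture mixture_setT.

End mixture.

Lemma measurable_enorm2 (R : realType) (d : nat) :
  measurable_fun setT (EFin \o (fun x : 'rV[R]_d => enorm x ^+ 2)).
Proof.
apply/measurable_EFinP; rewrite (_ : (fun _ => _) =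
    fun x : 'rV[R]_d => \sum_(i < d) x 0 i ^+ 2); last first.
  by apply/funext => x; rewrite sqr_sqrtr// sumr_ge0// => i _; rewrite sqr_ge0.
apply: measurable_sum => i; apply: measurable_funX.
apply: (measurability _ (RGenOpens.measurableE R)) => _ [_ [a [b ->]]] <-.
rewrite setTI; apply: sub_sigma_algebra.
by move/continuousP: (@coord_continuous R 1 d 0 i); apply; exact: itv_open.
Qed.

Section P2_mixture.
Context {R : realType} {d : nat}.
Variables (t : {i01 R}) (mu0 mu1 : P2 R d).

Lemma mixture_moment : finite_second_moment (mixture t mu0 mu1).
Proof.
rewrite /finite_second_moment /mixture.
have ge0 (x : 'rV[R]_d) : setT x -> (0 <= (enorm x ^+ 2)%:E)%E.
  by rewrite lee_fin sqr_ge0.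
rewrite ge0_integral_measure_add//; last exact: measurable_enorm2.
rewrite !ge0_integral_mscale//; [|exact: measurable_enorm2..].
by apply: lte_add_pinfty; apply: lte_mul_pinfty => //; exact: P2_moment.
Qed.

Definition P2_mixture : P2 R d := MkP2 mixture_moment.

End P2_mixture.

Section functionals.
Context {R : realType} {d : nat}.
Implicit Types V : P2 R d -> R.

Definition geodesic (mu : {i01 R} -> P2 R d) :=
  forall s t : {i01 R},
    W2 (mu s) (mu t) = `|s%:num - t%:num| * W2 (mu 0%:i01) (mu 1%:i01).

Definition displacement_convex (k : R) V :=
  forall mu : {i01 R} -> P2 R d, geodesic mu -> forall t : {i01 R},
    V (mu t) <= (1 - t%:num) * V (mu 0%:i01) + t%:num * V (mu 1%:i01)
      - k / 2 * t%:num * (1 - t%:num) * W2 (mu 0%:i01) (mu 1%:i01) ^+ 2.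

Definition classically_convex V :=
  forall (mu0 mu1 : P2 R d) (t : {i01 R}),
    V (P2_mixture t mu0 mu1) <= (1 - t%:num) * V mu0 + t%:num * V mu1.

Definition convolve (f : 'rV[R]_d -> R) (mu : P2 R d) (q : 'rV[R]_d) : R :=
  \int[mu]_y f (q - y).

Definition energy (phi1 phi : 'rV[R]_d -> R) (mu : P2 R d) : R :=
  1 / 2 * (\int[mu]_q convolve phi1 mu q) + \int[mu]_q phi q.

End functionals.

(* Main.v *)
Require Import Defs.
From HB Require Import structures.
From mathcomp Require Import all_boot all_order all_algebra.
From mathcomp Require Import all_classical all_reals all_analysis.
From mathcomp Require Import measurable_realfun ring lra.

Set Implicit Arguments.
Unset Strict Implicit.
Unset Printing Implicit Defensive.

Import Order.TTheory GRing.Theory Num.Theory.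
Import numFieldNormedType.Exports.

Local Open Scope classical_set_scope.
Local Open Scope ring_scope.

(** The proof of displacement convexity avoids optimal plans and disintegration.
    Given a geodesic and an intermediate time [t], take nearly optimal couplings
    of [(mu_0, mu_t)] and [(mu_t, mu_1)], and glue them along a countable
    partition of [R^d] into small cells, making the two couplings independent
    given the cell of the middle point.  Since
    [|z - ((1-t)x + ty)|^2 = (1-t)|x-z|^2 + t|z-y|^2 - t(1-t)|x-y|^2], the glued
    variables satisfy [Z = (1-t)X + tY] up to a small error in L^2.  A
    semiconvex function of quadratic growth is stable under such errors (write [Z] as a
    point close to [W = (1-t)X + tY] on the segment from [W] to
    [W + (Z-W)/s]), so the convexity inequalities of [phi] along [X, Y] and of
    [phi1] along [X - X', Y - Y'], with [(X', Y')] an independent copy, can be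
    integrated; the second one costs at most
    [|X-Y - (X'-Y')|^2 <= 2|X-Y|^2 + 2|X'-Y'|^2], whence [lambda - 2|lambda1|].

    Classical convexity fails on the segment between [(delta_{-h} + delta_h)/2]
    and [delta_0], [|h| = 1]: along it the interaction energy has the negative
    second difference produced by [phi1 0 = phi1 h = 1] and [phi1 (2h) = 0]. *)

(** * Squared Euclidean norm *)

Section enorm_theory.
Context {R : realType} {d : nat}.
Implicit Types x y z : 'rV[R]_d.

Lemma enorm2E x : enorm x ^+ 2 = \sum_(i < d) x 0 i ^+ 2.
Proof. by rewrite sqr_sqrtr// sumr_ge0// => i _; rewrite sqr_ge0. Qed.

Lemma enorm2_ge0 x : 0 <= enorm x ^+ 2.
Proof. exact: sqr_ge0. Qed.

Lemma enorm2_opp x : enorm (- x) ^+ 2 = enorm x ^+ 2.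
Proof. by rewrite !enorm2E; apply: eq_bigr => i _; rewrite !mxE; ring. Qed.

Lemma enorm2Z a x : enorm (a *: x) ^+ 2 = a ^+ 2 * enorm x ^+ 2.
Proof.
by rewrite !enorm2E mulr_sumr; apply: eq_bigr => i _; rewrite !mxE; ring.
Qed.

(** Coordinatewise, the cross term [2 * a * b] is absorbed by the squares [s^-1 * (s * a + b) ^+ 2]
    and [s^-1 * (s * a - b) ^+ 2]. The free parameter [s] keeps the coefficient of the leading term
    close to 1, and the absolute value serves semiconvexity constants of either sign. *)
Lemma enorm2_add_young (s : R) x y : 0 < s ->
  `|enorm (x + y) ^+ 2 - enorm x ^+ 2| <=
    s * enorm x ^+ 2 + (1 + s^-1) * enorm y ^+ 2.
Proof.
move=> s0; rewrite !enorm2E -sumrB !mulr_sumr -big_split/=.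
apply: le_trans (ler_norm_sum _ _ _) _; apply: ler_sum => i _; rewrite !mxE.
move: (x 0 i) (y 0 i) => a b.
have -> : (a + b) ^+ 2 - a ^+ 2 = 2 * a * b + b ^+ 2 by ring.
apply: le_trans (ler_normD _ _) _; rewrite [`|b ^+ 2|]ger0_norm ?sqr_ge0//.
have -> : s * a ^+ 2 + (1 + s^-1) * b ^+ 2 =
    (s * a ^+ 2 + s^-1 * b ^+ 2) + b ^+ 2 by ring.
rewrite lerD2r; apply/ler_normlP; split; rewrite -subr_ge0.
- have -> : s * a ^+ 2 + s^-1 * b ^+ 2 - - (2 * a * b) =
    s^-1 * (s * a + b) ^+ 2 by field; rewrite gt_eqF.
  by rewrite mulr_ge0 ?sqr_ge0// invr_ge0 ltW.
- have -> : s * a ^+ 2 + s^-1 * b ^+ 2 - 2 * a * b =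
    s^-1 * (s * a - b) ^+ 2 by field; rewrite gt_eqF.
  by rewrite mulr_ge0 ?sqr_ge0// invr_ge0 ltW.
Qed.

Lemma enorm2_add_le (s : R) x y : 0 < s ->
  enorm (x + y) ^+ 2 <= (1 + s) * enorm x ^+ 2 + (1 + s^-1) * enorm y ^+ 2.
Proof. by move=> s0; have /ler_normlP[_] := enorm2_add_young x y s0; lra. Qed.

Lemma enorm2_add x y :
  enorm (x + y) ^+ 2 <= 2 * enorm x ^+ 2 + 2 * enorm y ^+ 2.
Proof.
have /ler_normlP[_] := enorm2_add_young x y (@ltr01 R); rewrite invr1; lra.
Qed.

Lemma enorm2_sub x y :
  enorm (x - y) ^+ 2 <= 2 * enorm x ^+ 2 + 2 * enorm y ^+ 2.
Proof. by rewrite -(enorm2_opp y) enorm2_add. Qed.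

Lemma enorm2_segment (t : R) x y z :
  enorm (z - ((1 - t) *: x + t *: y)) ^+ 2 =
    (1 - t) * enorm (x - z) ^+ 2 + t * enorm (z - y) ^+ 2
    - t * (1 - t) * enorm (x - y) ^+ 2.
Proof.
rewrite !enorm2E !mulr_sumr -big_split/= -sumrB.
by apply: eq_bigr => i _; rewrite !mxE; ring.
Qed.

End enorm_theory.

(** * Stability of semiconvexity inequalities *)

Section semiconvex_perturbation.
Context {R : realType} {d : nat}.
Variables (f : 'rV[R]_d -> R) (l : R).
Hypothesis f_cvx : semiconvex l f.

Let g x := f x - l / 2 * enorm x ^+ 2.

Let g_cvx (t : R) x y : 0 <= t -> t <= 1 ->
  g ((1 - t) *: x + t *: y) <= (1 - t) * g x + t * g y.
Proof.
move=> t0 t1.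
have t01 : 0 <= 1 - t <= 1 by lra.
(* [conv] puts its parameter on the first point, hence the instance at [1 - t]. *)
have /= := f_cvx (Itv01 (proj1 (andP t01)) (proj2 (andP t01)))
  (in_setT x) (in_setT y).
by rewrite /conv/= /conv/= /unstable.onem subKr.
Qed.

Lemma semiconvex_segment (t : R) x y : 0 <= t -> t <= 1 ->
  f ((1 - t) *: x + t *: y) <=
    (1 - t) * f x + t * f y - l / 2 * (t * (1 - t) * enorm (x - y) ^+ 2).
Proof.
move=> t0 t1; have := g_cvx x y t0 t1; rewrite /g.
have := enorm2_segment t x y 0; rewrite sub0r enorm2_opp sub0r enorm2_opp.
by rewrite subr0 => ->; lra.
Qed.

(** [K] depends only on [C] and [l], so [s] stays free: if the squared distance from [z] to the
    segment point is of order [s ^+ 2], the whole error is of order [s]. *)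
Lemma semiconvex_perturbation (C : R) :
  (forall x, `|f x| <= C * (1 + enorm x ^+ 2)) ->
  exists2 K, 0 <= K & forall s t x y z, 0 < s -> s <= 1 -> 0 <= t -> t <= 1 ->
    f z <= (1 - t) * f x + t * f y - l / 2 * (t * (1 - t) * enorm (x - y) ^+ 2)
      + K * (s * (1 + enorm x ^+ 2 + enorm y ^+ 2)
             + s^-1 * enorm (z - ((1 - t) *: x + t *: y)) ^+ 2).
Proof.
move=> fC.
have C0 : 0 <= C.
  have := le_trans (normr_ge0 _) (fC 0).
  by rewrite pmulr_lge0// ltr_pwDl// enorm2_ge0.
set C' := C + `|l|.
have gC x : `|g x| <= C' * (1 + enorm x ^+ 2).
  rewrite /g; apply: le_trans (ler_normB _ _) _; rewrite /C' mulrDl.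
  apply: lerD; first exact: fC.
  rewrite normrM (ger0_norm (enorm2_ge0 x)) normrM (@ger0_norm _ 2^-1)//.
  have := enorm2_ge0 x; have := normr_ge0 l; nra.
have C'0 : 0 <= C' by rewrite addr_ge0.
exists (3 * C' + `|l|); first by have := normr_ge0 l; lra.
move=> s t x y z s0 s1 t0 t1.
set w := _ + t *: y; set v := z - w; set E := enorm v ^+ 2.
have E0 : 0 <= E := enorm2_ge0 v.
have si0 : 0 < s^-1 by rewrite invr_gt0.
have si1 : 1 <= s^-1 by rewrite invf_ge1.
have w2 : enorm w ^+ 2 <= enorm x ^+ 2 + enorm y ^+ 2.
  have := enorm2_segment t x y 0; rewrite sub0r enorm2_opp sub0r enorm2_opp.
  rewrite subr0 -/w => ->.
  have := enorm2_ge0 x; have := enorm2_ge0 y; have := enorm2_ge0 (x - y).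
  move: (_ ^+ 2) (enorm y ^+ 2) (enorm x ^+ 2) => a b c a0 b0 c0.
  have : 0 <= t * (1 - t) * a by rewrite !mulr_ge0// subr_ge0.
  nra.
(* Convexity of [g] between [w] and the far point [w + s^-1 *: v] puts weight only [s] on the
   latter. Quadratic growth at that point costs [s * s^-1 ^+ 2 * E], that is [s^-1 * E]. *)
have gz : g z <= g w + C' * (3 * (s * (1 + enorm w ^+ 2)) + 2 * (s^-1 * E)).
  have zE : z = (1 - s) *: w + s *: (w + s^-1 *: v).
    rewrite [s *: (_ + _)]scalerDr scalerA mulfV ?gt_eqF// scale1r addrA.
    rewrite -scalerDl subrK.
    by rewrite scale1r /v addrC subrK.
  rewrite {1}zE; apply: le_trans (g_cvx _ _ (ltW s0) s1) _.
  have /ler_normlP[gw _] := gC w.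
  have /ler_normlP[_ gv] := gC (w + s^-1 *: v).
  have := enorm2_add w (s^-1 *: v); rewrite enorm2Z -/E => vw.
  have sgw : s * - g w <= s * (C' * (1 + enorm w ^+ 2)).
    by rewrite ler_wpM2l// ltW.
  have sgv : s * g (w + s^-1 *: v) <=
      s * (C' * (1 + (2 * enorm w ^+ 2 + 2 * (s^-1 ^+ 2 * E)))).
    rewrite ler_wpM2l//; first exact: ltW.
    by apply: le_trans gv _; rewrite ler_wpM2l// lerD2l.
  have ssE : s * (s^-1 ^+ 2 * E) = s^-1 * E by field; rewrite gt_eqF.
  have sC' : 0 <= s * C' by rewrite mulr_ge0// ltW.
  have e : s * (C' * (1 + (2 * enorm w ^+ 2 + 2 * (s^-1 ^+ 2 * E)))) =
    C' * (s + 2 * (s * enorm w ^+ 2) + 2 * (s^-1 * E)) by rewrite -ssE; ring.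
  rewrite e in sgv; move: (g (w + _)) sgv => G sgv.
  have -> : C' * (3 * (s * (1 + enorm w ^+ 2)) + 2 * (s^-1 * E)) =
    s * (C' * (1 + enorm w ^+ 2)) + 2 * (s * C') +
    C' * (2 * (s * enorm w ^+ 2) + 2 * (s^-1 * E)) by ring.
  have : C' * (s + 2 * (s * enorm w ^+ 2) + 2 * (s^-1 * E)) = s * C' +
    C' * (2 * (s * enorm w ^+ 2) + 2 * (s^-1 * E)) by ring.
  lra.
(* The quadratic part, whose sign is unknown, is moved from [z] to [w] by Young's inequality with
   the same [s]; [s <= 1] lets [s^-1 * E] dominate [E]. *)
have lz : l / 2 * enorm z ^+ 2 <= l / 2 * enorm w ^+ 2 +
    `|l| * (s * enorm w ^+ 2 + s^-1 * E).
  have := enorm2_add_young w v s0; rewrite {1}/v [w + _]addrC subrK -/E => le1.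
  rewrite -lerBlDl -mulrBr; apply: le_trans (ler_norm _) _.
  rewrite normrM normrM (@ger0_norm _ 2^-1)// -mulrA ler_wpM2l//.
  have := enorm2_ge0 w; have : E <= s^-1 * E by rewrite ler_peMl.
  move: le1 si1 E0; rewrite mulrDl mul1r.
  have : 0 <= s * enorm w ^+ 2 by rewrite mulr_ge0 ?enorm2_ge0// ltW.
  lra.
have := semiconvex_segment x y t0 t1; rewrite -/w => fw.
have -> : f z = g z + l / 2 * enorm z ^+ 2 by rewrite /g subrK.
have gfw : g w + l / 2 * enorm w ^+ 2 = f w by rewrite /g subrK.
have sw : s * (1 + enorm w ^+ 2) <= s * (1 + enorm x ^+ 2 + enorm y ^+ 2).
  by rewrite ler_wpM2l ?(ltW s0)// -addrA lerD2l.
set S := s * (1 + enorm x ^+ 2 + _) in sw *.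
have sE0 : 0 <= s^-1 * E by rewrite mulr_ge0// ltW.
have sw' : s * enorm w ^+ 2 <= S by apply: le_trans sw; rewrite mulrDr; lra.
have h1 : C' * (3 * (s * (1 + enorm w ^+ 2)) + 2 * (s^-1 * E)) <=
    C' * (3 * (S + s^-1 * E)) by rewrite ler_wpM2l//; lra.
have h2 : `|l| * (s * enorm w ^+ 2 + s^-1 * E) <= `|l| * (S + s^-1 * E).
  by rewrite ler_wpM2l//; lra.
move: gz lz gfw fw h1 h2; move: (_ * (s * _ + s^-1 * E)) (C' * (_ + 2 * _)).
rewrite mulrDl; move: (l / 2 * enorm z ^+ 2) (l / 2 * enorm w ^+ 2) => *.
lra.
Qed.

End semiconvex_perturbation.

(** * Quadratic growth from bounded second derivatives *)

Lemma le_increment_derive (R : realType) (g dg : R -> R) (a B : R) :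
    (forall t : R, is_derive t 1 g (dg t)) ->
    (forall t : R, `|t| <= `|a| -> `|dg t| <= B) ->
  `|g a - g 0| <= B * `|a|.
Proof.
move=> gd dgB.
have cg (i : interval R) : {within [set` i], continuous g}.
  by apply: derivable_within_continuous => t _; apply: ex_derive; exact: gd.
have [a0|a0] := leP 0 a.
- have [c cI ->] := MVT_segment a0 (fun t _ => gd t) (cg _).
  rewrite subr0 normrM ler_wpM2r// dgB//; move: cI; rewrite in_itv/=.
  by move=> /andP[c0 ca]; rewrite !ger0_norm.
- have [c cI] := MVT_segment (ltW a0) (fun t _ => gd t) (cg _).
  rewrite -normrN opprB => ->; rewrite sub0r normrM normrN ler_wpM2r// dgB//.
  move: cI; rewrite in_itv/= => /andP[ac c0].
  by rewrite !ler0_norm ?(ltW a0)// lerN2.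
Qed.

Lemma le_1Dsqr (R : realType) (a : R) : a <= 1 + a ^+ 2.
Proof. by have := sqr_ge0 (a - 1); have := sqr_ge0 a; lra. Qed.

Section growth.
Context {R : realType} {d : nat}.
Implicit Types (f : 'rV[R]_d -> R) (x y : 'rV[R]_d).

Lemma has_partials_line f i x (t : R) : has_partials f ->
  is_derive t 1 (fun h => f (h *: delta_mx 0 i + x))
    (partial i f (t *: delta_mx 0 i + x)).
Proof.
move=> fp; have := fp i (t *: delta_mx 0 i + x).
rewrite /derivable /partial /derive.
set q := (X in cvg (X @ _)); move=> cq.
pose q' h := h^-1 *: (((fun h : R => f (h *: delta_mx 0 i + x)) \o shift t)
  (h *: 1) - f (t *: delta_mx 0 i + x)).
have qE : q = q'.
  apply/funext => h; rewrite /q /q' /=; congr (_ *: (f _ - _)).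
  by rewrite addrA -scalerDl [h *: 1]mulr1.
by apply: DeriveDef; rewrite ?/derivable ?/derive -/q' -qE.
Qed.

(** Since [y] vanishes in coordinate [i], every point between [y] and [a *: delta_mx 0 i + y]
    remains in the cube of radius [r], where the bound on the partial derivative is available. *)
Lemma coord_increment f (B r a : R) i y : has_partials f ->
    (forall x, (forall j, `|x 0 j| <= r) -> `|partial i f x| <= B) ->
    (forall j, `|y 0 j| <= r) -> y 0 i = 0 -> `|a| <= r ->
  `|f (a *: delta_mx 0 i + y) - f y| <= B * r.
Proof.
move=> fp fB yr yi ar.
have B0 : 0 <= B by apply: le_trans (fB _ yr).
have := le_increment_derive (a := a) (fun t => has_partials_line i y t fp).
rewrite scale0r add0r => /(_ B) incr; apply: le_trans (incr _) _; last first.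
  by rewrite ler_wpM2l.
move=> t ta; apply: fB => j; rewrite !mxE eqxx/=.
have [->|ji] := eqVneq j i; first by rewrite yi mulr1 addr0 (le_trans ta).
by rewrite mulr0 add0r.
Qed.

(** The path from 0 to [x] turns on one coordinate at a time, so partial derivatives suffice and no
    total differential is needed; each of the [d] moves costs at most [B * r]. *)
Lemma increment_le f (B r : R) x : has_partials f ->
    (forall i y, (forall j, `|y 0 j| <= r) -> `|partial i f y| <= B) ->
    (forall j, `|x 0 j| <= r) ->
  `|f x - f 0| <= d%:R * (B * r).
Proof.
move=> fp fB xr.
pose y k : 'rV[R]_d := \row_j (if (j < k)%N then x 0 j else 0).
(* The sign of [r] is known only through some coordinate of [x]; for [d = 0] there is none. *)
have r0 : (0 < d)%N -> 0 <= r by move=> d0; apply: le_trans (xr (Ordinal d0)).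
have yr k j : `|y k 0 j| <= r.
  rewrite mxE; case: ifP => _; first exact: xr.
  by rewrite normr0 r0//; case: d j => // -[].
have y0 : y 0%N = 0 by apply/rowP => j; rewrite !mxE.
have yd : y d = x by apply/rowP => j; rewrite !mxE ltn_ord.
suff H k : (k <= d)%N -> `|f (y k) - f 0| <= k%:R * (B * r) by rewrite -yd H.
elim: k => [_|k IH kd]; first by rewrite y0 subrr normr0 mul0r.
pose i := Ordinal kd.
have yS : y k.+1 = x 0 i *: delta_mx 0 i + y k.
  apply/rowP => j; rewrite !mxE eqxx/= ltnS leq_eqVlt.
  have [->|ji] := eqVneq j i; first by rewrite eqxx ltnn mulr1 addr0.
  by rewrite (_ : (nat_of_ord j == k) = false) ?mulr0 ?add0r//; apply/negbTE.
have -> : f (y k.+1) - f 0 = (f (y k.+1) - f (y k)) + (f (y k) - f 0) by ring.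
apply: le_trans (ler_normD _ _) _; rewrite -natr1 mulrDl mul1r addrC.
apply: lerD; first exact/IH/ltnW.
rewrite yS; apply: coord_increment => //; first exact: fB.
by rewrite mxE ltnn.
Qed.

Lemma coord_le_enorm x j : `|x 0 j| <= enorm x.
Proof.
rewrite -sqrtr_sqr ler_wsqrtr// (bigD1 j)//= lerDl sumr_ge0// => k _.
exact: sqr_ge0.
Qed.

(** [increment_le] is applied twice: bounded second derivatives make the first ones grow linearly,
    and these make [f] grow quadratically. *)
Lemma quadratic_growth f : class_C2 f -> bounded_second_derivatives f ->
  exists2 C, 0 <= C & forall x, `|f x| <= C * (1 + enorm x ^+ 2).
Proof.
move=> [_ fp _ fpp _] [M fM].
pose A := \sum_(i < d) `|partial i f 0|.
have A0 : 0 <= A by rewrite sumr_ge0.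
have M0 (i : 'I_d) : 0 <= M by apply: le_trans (fM i i 0).
(* The maximum with 0 covers [d = 0], where the bound is vacuous and [M] may be negative. *)
pose D := d%:R * Num.max M 0.
have D0 : 0 <= D by rewrite mulr_ge0// le_max lexx orbT.
have pB r i y : (forall j, `|y 0 j| <= r) -> `|partial i f y| <= A + D * r.
  move=> yr; have := increment_le (fpp i) (fun j z _ => fM i j z) yr.
  rewrite mulrA => incr; rewrite -(subrK (partial i f 0) (partial i f y)).
  apply: le_trans (ler_normD _ _) _; rewrite addrC; apply: lerD.
    by rewrite /A (bigD1 i)//= lerDl sumr_ge0.
  by rewrite /D max_l// (M0 i).
pose C := `|f 0| + d%:R * (A + D).
exists C; first by rewrite addr_ge0// mulr_ge0// addr_ge0.
move=> x; have := increment_le fp (pB (enorm x)) (coord_le_enorm x).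
have e0 : 0 <= enorm x := sqrtr_ge0 _.
move=> incr; rewrite -(subrK (f 0) (f x)).
apply: le_trans (ler_normD _ _) _.
rewrite /C mulrDl addrC; apply: lerD; first by rewrite ler_peMr// lerDl sqr_ge0.
apply: le_trans incr _; rewrite -[leRHS]mulrA ler_wpM2l//.
rewrite mulrDl mulrDl; apply: lerD; last first.
  by rewrite -mulrA ler_wpM2l// -expr2 lerDr.
by rewrite ler_wpM2l// le_1Dsqr.
Qed.

End growth.

(** * Cubic cells and Borel measurability *)

Section cells.
Context {R : realType} {d : nat}.
Implicit Types (x y : 'rV[R]_d) (k : 'rV[int]_d).

(** The cells at level [n] are half-open cubes of side [n.+1%:R^-1], labelled by integer vectors.
    Their countability serves both measurability and the gluing of couplings. *)
Definition cell_index (n : nat) x : 'rV[int]_d :=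
  map_mx (fun a => Num.floor (n.+1%:R * a)) x.

Lemma cell_index_close n x y i :
  cell_index n x = cell_index n y -> `|x 0 i - y 0 i| < n.+1%:R^-1.
Proof.
move=> /rowP/(_ i); rewrite !mxE => xy.
have := floor_itv (n.+1%:R * x 0 i); have := floor_itv (n.+1%:R * y 0 i).
rewrite xy !intrD => /andP[y1 y2] /andP[x1 x2].
rewrite -[ltRHS]mul1r ltr_pdivlMr// -(@ger0_norm _ n.+1%:R)// -normrM.
by rewrite mulrC mulrBr; apply/ltr_normlP; split; lra.
Qed.

(** Balls for the library norm are cubes, so each point of [U] has a sufficiently fine cell inside
    [U]; the union is over a countable type. *)
Lemma open_cell_cover (U : set 'rV[R]_d) : open U ->
  U = \bigcup_(p in [set p : nat * 'rV[int]_d |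
                       cell_index p.1 @^-1` [set p.2] `<=` U])
        cell_index p.1 @^-1` [set p.2].
Proof.
move=> oU; apply/seteqP; split=> [x Ux|x [p pU /pU]//].
have /nbhs_ballP[e /= e0 eU] : nbhs x U by exact: open_nbhs_nbhs.
pose n := Num.truncn e^-1.
have en : n.+1%:R^-1 < e.
  by rewrite invf_plt ?posrE// truncnS_gt// invr_ge0 ltW.
exists (n, cell_index n x) => //= y /esym xy; apply: eU; split => // i j.
rewrite (ord1 i); apply: lt_trans en; exact: cell_index_close.
Qed.

Lemma measurable_cell_preimage d' (T : measurableType d') (f : T -> 'rV[R]_d)
    n k : (forall i, measurable_fun setT (fun t => f t 0 i)) ->
  measurable (f @^-1` (cell_index n @^-1` [set k])).
Proof.
move=> mf; rewrite (_ : _ @^-1` _ = \bigcap_(i in [set: 'I_d])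
    (fun t => n.+1%:R * f t 0 i) @^-1`
      `[(k 0 i)%:~R, (k 0 i + 1)%:~R[%classic); last first.
  apply/seteqP; split=> [t /rowP pt i _|t pt]/=.
    by have := pt i; rewrite !mxE => <-; rewrite in_itv/= floor_itv.
  apply/rowP => i; rewrite !mxE; apply/eqP; rewrite floor_eq.
  by have := pt i I; rewrite /= in_itv.
apply: fin_bigcap_measurable => // i _; rewrite -[_ @^-1` _]setTI.
have mfi : measurable_fun setT (fun t => n.+1%:R * f t 0 i).
  by apply: measurable_funM => //; exact: mf.
by apply: mfi => //; exact: measurable_itv.
Qed.

(** The sigma-algebra is generated by open sets, not by coordinates; the countable cell cover
    bridges the two, as each cell is a finite intersection of coordinate conditions. *)
Lemma measurable_fun_rV d' (T : measurableType d') (f : T -> 'rV[R]_d) :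
  (forall i, measurable_fun setT (fun t => f t 0 i)) -> measurable_fun setT f.
Proof.
move=> mf; apply: (@measurability _ _ _ _ setT f open); first by [].
move=> _ [U oU <-]; rewrite setTI (open_cell_cover oU) preimage_bigcup.
rewrite bigcup_mkcond; apply: countable_bigcupT_measurable => // p.
by case: ifP => // _; exact: measurable_cell_preimage.
Qed.

Lemma continuous_measurable_rV (f : 'rV[R]_d -> R) :
  continuous f -> measurable_fun setT f.
Proof.
move=> cf; apply: (measurability _ (RGenOpens.measurableE R)).
move=> _ [_ [a [b ->]]] <-; rewrite setTI; apply: sub_sigma_algebra.
by move/continuousP: cf; apply; exact: itv_open.
Qed.

Lemma measurable_coord i : measurable_fun setT (fun x : 'rV[R]_d => x 0 i).
Proof. by apply: continuous_measurable_rV; exact: coord_continuous. Qed.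

Lemma measurable_cell n k : measurable (cell_index n @^-1` [set k]).
Proof.
by apply: (@measurable_cell_preimage _ _ idfun); exact: measurable_coord.
Qed.

End cells.

(** * Measurability of vector operations *)

Section measurable_vector_operations.
Context {R : realType} {d : nat} d' (T : measurableType d').
Implicit Types f g : T -> 'rV[R]_d.

Lemma measurable_funD_rV f g : measurable_fun setT f -> measurable_fun setT g ->
  measurable_fun setT (fun t => f t + g t).
Proof.
move=> mf mg; apply: measurable_fun_rV => i; under eq_fun do rewrite mxE.
by apply: measurable_funD; apply: (measurableT_comp (measurable_coord i)).
Qed.

Lemma measurable_funZ_rV (a : R) f : measurable_fun setT f ->
  measurable_fun setT (fun t => a *: f t).
Proof.
move=> mf; apply: measurable_fun_rV => i; under eq_fun do rewrite mxE.
by apply: measurable_funM => //; apply: (measurableT_comp (measurable_coord i)).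
Qed.

Lemma measurable_fun_enorm2 f : measurable_fun setT f ->
  measurable_fun setT (fun t => enorm (f t) ^+ 2).
Proof.
have /measurable_EFinP m := @measurable_enorm2 R d.
by move=> mf; exact: (measurableT_comp m mf).
Qed.

End measurable_vector_operations.

(** * Approximate gluing of two couplings along a countable partition *)

Section gluing.
Context {R : realType} d1 d d2 (T1 : measurableType d1) (T : measurableType d)
  (T2 : measurableType d2).
Variables (g1 : probability (T1 * T)%type R) (g2 : probability (T * T2)%type R).
Hypothesis g12 : forall B, measurable B -> g1 (snd @^-1` B) = g2 (fst @^-1` B).
Variables (idx : T -> nat).
Hypothesis measurable_idx : forall k, measurable (idx @^-1` [set k]).

Let A1 k : set (T1 * T) := (fun p => idx p.2) @^-1` [set k].
Let A2 k : set (T * T2) := (fun p => idx p.1) @^-1` [set k].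

Let mA1 k : measurable (A1 k).
Proof.
rewrite /A1 -[X in measurable X]setTI.
exact: (@measurable_snd _ _ T1 T measurableT _ (measurable_idx k)).
Qed.

Let mA2 k : measurable (A2 k).
Proof.
rewrite /A2 -[X in measurable X]setTI.
exact: (@measurable_fst _ _ T T2 measurableT _ (measurable_idx k)).
Qed.

Let g12A k : g1 (A1 k) = g2 (A2 k).
Proof. exact: g12 (measurable_idx k). Qed.

Let weight_ge0 k : 0 <= (fine (g2 (A2 k)))^-1.
Proof. by rewrite invr_ge0 fine_ge0. Qed.

Let weight k : {nonneg R} := NngNum (weight_ge0 k).

(** On cell [k] the restricted couplings are made independent, and dividing by the common mass of
    the cell restores the marginals. For a null cell the inverse of 0 is 0 and the piece vanishes,
    as it should. *)
Let piece k : {measure set ((T1 * T) * (T * T2)) -> \bar R} :=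
  mscale (weight k) (mrestr g1 (mA1 k) \x mrestr g2 (mA2 k))%E.

Definition glue : set ((T1 * T) * (T * T2)) -> \bar R := mseries piece 0.

HB.instance Definition _ := Measure.on glue.

Let pieceE k E1 E2 : measurable E1 -> measurable E2 ->
  piece k (E1 `*` E2) =
    ((fine (g2 (A2 k)))^-1%:E * (g1 (E1 `&` A1 k) * g2 (E2 `&` A2 k)))%E.
Proof.
move=> mE1 mE2; rewrite {1}/piece/= /mscale; congr (_ * _)%E.
exact: product_measure1E.
Qed.

Let series_fibers d' (X : measurableType d') (m : {measure set X -> \bar R})
    (u : X -> nat) E :
    measurable E -> (forall k, measurable (u @^-1` [set k])) ->
  (\sum_(0 <= k <oo) m (E `&` u @^-1` [set k]) = m E)%E.
Proof.
move=> mE mu.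
have {2}-> : E = \bigcup_k (E `&` u @^-1` [set k]).
  rewrite -setI_bigcupr; apply/seteqP; split=> [x Ex|x []//].
  by split=> //; exists (u x).
rewrite measure_bigcup//.
- by apply: eq_eseriesl => // k; rewrite in_setT.
- by move=> k _; exact: measurableI.
- exact/trivIset_setIl/trivIset_preimage1.
Qed.

Let weightK k : g2 (A2 k) != 0%E ->
  ((fine (g2 (A2 k)))^-1%:E * g2 (A2 k) = 1)%E.
Proof.
move=> g0; rewrite -{2}(@fineK _ (g2 (A2 k))) ?fin_num_measure// -EFinM mulVf//.
by rewrite fine_eq0// fin_num_measure.
Qed.

Let measureI0 d' (X : measurableType d') (m : {measure set X -> \bar R}) E A :
  measurable E -> measurable A -> m A = 0%E -> m (E `&` A) = 0%E.
Proof.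
move=> mE mA m0; apply/eqP; rewrite -measure_le0 -m0.
by apply: le_measure; rewrite ?inE//; exact: measurableI.
Qed.

(** In each piece the mass of the second factor cancels the weight. On a null cell nothing cancels,
    but both sides are 0 because [g1] and [g2] give the cell the same mass. *)
Let glue_fst E : measurable E -> glue (E `*` setT) = g1 E.
Proof.
move=> mE; rewrite -[RHS](@series_fibers _ _ _ (fun p => idx p.2))//.
apply: eq_eseriesr => k _; rewrite pieceE// setTI.
have [g0|g0] := eqVneq (g2 (A2 k)) 0%E.
  rewrite g0 !mule0; apply/esym.
  exact: (measureI0 mE (mA1 k) (etrans (g12A k) g0)).
by rewrite [X in (_ * X)%E]muleC muleA weightK// mul1e.
Qed.

Let glue_snd E : measurable E -> glue (setT `*` E) = g2 E.
Proof.
move=> mE; rewrite -[RHS](@series_fibers _ _ _ (fun p => idx p.1))//.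
apply: eq_eseriesr => k _; rewrite pieceE// setTI.
have [g0|g0] := eqVneq (g2 (A2 k)) 0%E.
  rewrite g12A g0 mul0e !mule0; apply/esym.
  exact: (measureI0 mE (mA2 k) g0).
by rewrite muleA g12A weightK// mul1e.
Qed.

Let glue_setT : glue setT = 1%E.
Proof. by rewrite -setXTT glue_fst// probability_setT. Qed.

HB.instance Definition _ := Measure_isProbability.Build _ _ _ glue glue_setT.

Let diag : set ((T1 * T) * (T * T2)) := \bigcup_k (A1 k `*` A2 k).

Let mdiag : measurable diag.
Proof. by apply: bigcupT_measurable => k; exact: measurableX. Qed.

(** Piece [k] lives on [A1 k] times [A2 k]: outside [diag], one of the two factors falls in the
    complement of its cell. *)
Let glue_diag : glue (~` diag) = 0%E.
Proof.
apply: eseries0 => k _ _; apply/eqP; rewrite -measure_le0.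
have mC1 := measurableC (mA1 k); have mC2 := measurableC (mA2 k).
have m1 : measurable (~` A1 k `*` [set: T * T2]) by exact: measurableX.
have m2 : measurable ([set: T1 * T] `*` ~` A2 k) by exact: measurableX.
apply: (@le_trans _ _ (piece k (~` A1 k `*` setT `|` setT `*` ~` A2 k))).
  apply: le_measure; rewrite ?inE; [exact: measurableC|exact: measurableU|].
  move=> [p q] npq; have [pk|pk] := pselect (A1 k p); last by left.
  by right; split => // qk; apply: npq; exists k.
apply: le_trans (measureU2 _ m1 m2) _.
have p1 : piece k (~` A1 k `*` setT) = 0%E.
  by rewrite pieceE ?setICl ?measure0 ?mul0e ?mule0//; exact: measurableC.
have p2 : piece k (setT `*` ~` A2 k) = 0%E.
  by rewrite pieceE ?setICl ?measure0 ?mule0//; exact: measurableC.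
by rewrite le_eqVlt; apply/orP; left; apply/eqP; rewrite -[RHS]adde0 -{1}p1 -p2.
Qed.

(** The two middle points need only share a cell instead of being equal, so arbitrary measurable
    spaces are allowed and no conditional laws are required. *)
Lemma approximate_gluing : exists P : probability ((T1 * T) * (T * T2))%type R,
  [/\ forall E, measurable E -> P (fst @^-1` E) = g1 E,
      forall E, measurable E -> P (snd @^-1` E) = g2 E &
      {ae P, forall p, idx p.1.2 = idx p.2.1}].
Proof.
exists glue; split.
- move=> E mE; rewrite -(glue_fst mE); congr glue.
  by apply/seteqP; split=> p //= [].
- move=> E mE; rewrite -(glue_snd mE); congr glue.
  by apply/seteqP; split=> p //= [].
- exists (~` diag); split=> //; first exact: measurableC.
  by move=> p /= np [k _ [/= p1 p2]]; apply: np; rewrite p1 p2.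
Qed.

End gluing.

(** * Real integrals, change of variables and square integrability *)

Section real_integrable.
Context {R : realType} d (T : measurableType d).

Definition Rintegrable (P : {measure set T -> \bar R}) (f : T -> R) : Prop :=
  P.-integrable setT (EFin \o f).

Section measure_theory.
Variable P : {measure set T -> \bar R}.
Implicit Types f g : T -> R.

Lemma RintegrableD f g : Rintegrable P f -> Rintegrable P g ->
  Rintegrable P (fun x => f x + g x).
Proof. by move=> fi gi; apply: eq_integrable (integrableD _ fi gi). Qed.

Lemma RintegrableB f g : Rintegrable P f -> Rintegrable P g ->
  Rintegrable P (fun x => f x - g x).
Proof. by move=> fi gi; apply: eq_integrable (integrableB _ fi gi). Qed.

Lemma RintegrableZ (a : R) f : Rintegrable P f ->
  Rintegrable P (fun x => a * f x).
Proof. by move=> fi; apply: eq_integrable (integrableZl _ a fi). Qed.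

Lemma le_Rintegrable f g : measurable_fun setT f ->
  (forall x, `|f x| <= g x) -> Rintegrable P g -> Rintegrable P f.
Proof.
move=> mf fg; apply: le_integrable => //; first exact/measurable_EFinP.
by move=> x _; rewrite !abse_EFin lee_fin (le_trans (fg x))// ler_norm.
Qed.

Lemma EFin_Rintegral f : Rintegrable P f ->
  (\int[P]_x f x)%:E = (\int[P]_x (f x)%:E)%E.
Proof. by move=> fi; rewrite fineK// integrable_fin_num. Qed.

End measure_theory.

Lemma Rintegrable_cst (P : probability T R) (a : R) : Rintegrable P (cst a).
Proof. exact: finite_measure_integrable_cst. Qed.

Lemma Rintegral_cst1 (P : probability T R) (a : R) : \int[P]_x a = a.
Proof.
rewrite Rintegral_cst// -[RHS]mulr1; congr (_ * _).
exact: (congr1 fine (probability_setT P)).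
Qed.

End real_integrable.

Section law.
Context {R : realType} d d' (T : measurableType d) (T' : measurableType d').
Variables (P : {measure set T -> \bar R}) (mu : {measure set T' -> \bar R}).
Variable Z : T -> T'.
Hypothesis mZ : measurable_fun setT Z.
Hypothesis lawZ : forall A, measurable A -> P (Z @^-1` A) = mu A.

Lemma ge0_integral_law (f : T' -> \bar R) : measurable_fun setT f ->
  (forall x, 0 <= f x)%E -> (\int[P]_x f (Z x) = \int[mu]_y f y)%E.
Proof.
move=> mf f0;
rewrite -[LHS](ge0_integral_pushforward mZ P (D := setT) (f := f))//.
by apply: eq_measure_integral => A mA _; exact: lawZ.
Qed.

Lemma Rintegrable_law (f : T' -> R) : Rintegrable mu f ->
  Rintegrable P (f \o Z).
Proof.
move=> /integrableP[mf fi]; apply/integrableP; split.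
  exact: (measurableT_comp mf mZ).
rewrite [X in (X < _)%E](_ : _ = \int[mu]_y `|(f y)%:E|)%E//.
by rewrite -ge0_integral_law//; exact: measurableT_comp.
Qed.

Lemma Rintegral_law (f : T' -> R) : Rintegrable mu f ->
  \int[P]_x f (Z x) = \int[mu]_y f y.
Proof.
move=> fi; have mf := measurable_int _ fi.
have fZi := Rintegrable_law fi.
have := integral_pushforward mZ mf (fZi : P.-integrable (Z @^-1` setT) _)
  measurableT.
rewrite preimage_setT => pZ; congr fine; apply: (etrans (esym pZ)).
by apply: eq_measure_integral => A mA _; exact: lawZ.
Qed.

End law.

Section square_integrable.
Context {R : realType} {d : nat} d' (T : measurableType d').
Variable P : probability T R.
Implicit Types X Y : T -> 'rV[R]_d.

Definition square_integrable X :=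
  measurable_fun setT X /\ Rintegrable P (fun w => enorm (X w) ^+ 2).

Lemma square_integrableD X Y : square_integrable X -> square_integrable Y ->
  square_integrable (fun w => X w + Y w).
Proof.
move=> [mX iX] [mY iY]; have mXY := measurable_funD_rV mX mY; split=> //.
apply: (le_Rintegrable
  (g := fun w => 2 * enorm (X w) ^+ 2 + 2 * enorm (Y w) ^+ 2)).
- exact: measurable_fun_enorm2.
- by move=> w; rewrite ger0_norm ?enorm2_ge0// enorm2_add.
- by apply: RintegrableD; exact: RintegrableZ.
Qed.

Lemma square_integrableZ (a : R) X : square_integrable X ->
  square_integrable (fun w => a *: X w).
Proof.
move=> [mX iX]; split; first exact: measurable_funZ_rV.
by under eq_fun do rewrite enorm2Z; exact: RintegrableZ.
Qed.

Lemma square_integrableB X Y : square_integrable X -> square_integrable Y ->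
  square_integrable (fun w => X w - Y w).
Proof.
move=> iX iY; under eq_fun do rewrite -scaleN1r.
by apply: square_integrableD => //; exact: square_integrableZ.
Qed.

Lemma Rintegrable_growth (f : 'rV[R]_d -> R) C X : continuous f ->
  (forall x, `|f x| <= C * (1 + enorm x ^+ 2)) -> square_integrable X ->
  Rintegrable P (fun w => f (X w)).
Proof.
move=> cf fC [mX iX].
apply: (le_Rintegrable (g := fun w => C * (1 + enorm (X w) ^+ 2))).
- exact: (measurableT_comp (continuous_measurable_rV cf) mX).
- by move=> w; exact: fC.
- by apply: RintegrableZ; apply: RintegrableD => //; exact: Rintegrable_cst.
Qed.

End square_integrable.

Lemma square_integrable_law (R : realType) n d d' (T : measurableType d)
    (T' : measurableType d') (P : probability T R) (Q : probability T' R)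
    (Z : T -> T') (X : T' -> 'rV[R]_n) : measurable_fun setT Z ->
    (forall A, measurable A -> P (Z @^-1` A) = Q A) ->
  square_integrable Q X -> square_integrable P (X \o Z).
Proof.
move=> mZ lawZ [mX iX]; split; first exact: measurableT_comp.
exact: (Rintegrable_law mZ lawZ iX).
Qed.

Lemma square_integrable_P2 (R : realType) n (mu : P2 R n) :
  square_integrable mu idfun.
Proof.
split; first exact: measurable_id.
apply: (introT (integrableP (P2_probability mu) setT
  (EFin \o (fun x => enorm x ^+ 2)))); split.
  exact: measurable_enorm2.
apply: le_lt_trans (P2_moment mu); rewrite le_eqVlt; apply/orP; left; apply/eqP.
by apply: eq_integral => x _; rewrite /= ger0_norm ?enorm2_ge0.
Qed.

(** * Marginals of a product probability *)

Section product_law.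
Context {R : realType} d1 d2 (T1 : measurableType d1) (T2 : measurableType d2).
Variables (P1 : probability T1 R) (P2 : probability T2 R).

Lemma product_fst A : measurable A -> (P1 \x P2)%E (fst @^-1` A) = P1 A.
Proof.
move=> mA; rewrite (_ : _ @^-1` _ = A `*` setT).
  apply: etrans (product_measure1E _ _ mA measurableT) _.
  exact: etrans (congr1 (mule _) (probability_setT P2)) (mule1 _).
by apply/seteqP; split=> p //= [].
Qed.

Lemma product_snd A : measurable A -> (P1 \x P2)%E (snd @^-1` A) = P2 A.
Proof.
move=> mA; rewrite (_ : _ @^-1` _ = setT `*` A).
  apply: etrans (product_measure1E _ _ measurableT mA) _.
  exact: etrans (congr1 (mule^~ _) (probability_setT P1)) (mul1e _).
by apply/seteqP; split=> p //= [].
Qed.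

End product_law.

(** * Nearly optimal couplings *)

Section wasserstein.
Context {R : realType} {n : nat}.
Implicit Types (mu nu : P2 R n).

Lemma coupling_square_integrable mu nu g : coupling mu nu g ->
  square_integrable g (fun z => z.1 - z.2).
Proof.
move=> cg; apply: square_integrableB.
- apply: (@square_integrable_law _ _ _ _ _ _ g mu fst idfun measurable_fst).
    by move=> A /cg[].
  exact: square_integrable_P2.
- apply: (@square_integrable_law _ _ _ _ _ _ g nu snd idfun measurable_snd).
    by move=> A /cg[].
  exact: square_integrable_P2.
Qed.

Let cost (g : probability ('rV[R]_n * 'rV[R]_n)%type R) :=
  \int[g]_z enorm (z.1 - z.2) ^+ 2.

Let costs mu nu := [set (\int[g]_z (enorm (z.1 - z.2) ^+ 2)%:E)%E |
  g in coupling mu nu].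

Let costE mu nu g : coupling mu nu g ->
  (cost g)%:E = (\int[g]_z (enorm (z.1 - z.2) ^+ 2)%:E)%E.
Proof. by move=> /coupling_square_integrable[_ ?]; exact: EFin_Rintegral. Qed.

Let coupling_product mu nu : coupling mu nu (mu \x nu)%E.
Proof.
move=> A mA; split; [exact: product_fst|exact: product_snd].
Qed.

(** The product coupling has finite cost, so the infimum is finite and neither [fine] nor the square
    root in [W2] loses information. *)
Let inf_costs mu nu : ereal_inf (costs mu nu) = (W2 mu nu ^+ 2)%:E.
Proof.
have inf_ge0 : (0 <= ereal_inf (costs mu nu))%E.
  apply: le_ereal_inf_tmp => _ [g cg <-]; apply: integral_ge0 => z _.
  by rewrite lee_fin enorm2_ge0.
rewrite /W2 sqr_sqrtr ?fine_ge0// fineK// ge0_fin_numE//.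
apply: (@le_lt_trans _ _ (cost (mu \x nu)%E)%:E); last exact: ltry.
rewrite (costE (coupling_product mu nu)).
by apply: ereal_inf_lbound; exists (mu \x nu)%E => //; exact: coupling_product.
Qed.

Lemma W2_le_cost mu nu g : coupling mu nu g ->
  W2 mu nu ^+ 2 <= \int[g]_z enorm (z.1 - z.2) ^+ 2.
Proof.
move=> cg; rewrite -lee_fin -inf_costs (costE cg).
by apply: ereal_inf_lbound; exists g.
Qed.

Lemma W2_approx mu nu (e : R) : 0 < e -> exists2 g, coupling mu nu g &
  \int[g]_z enorm (z.1 - z.2) ^+ 2 <= W2 mu nu ^+ 2 + e.
Proof.
move=> e0.
have := @lb_ereal_inf_adherent _ (costs mu nu) e e0; rewrite inf_costs.
move=> /(_ isT)[_ [g cg <-]]; rewrite -(costE cg) -EFinD lte_fin => /ltW ge.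
by exists g.
Qed.

End wasserstein.

(** * Approximate interpolation between the ends of a geodesic *)

Section approximate_midpoint.
Context {R : realType} {d : nat}.

(** The gluing takes a partition indexed by [nat]; injectivity of [pickle] makes each nonempty fibre
    exactly one cell. *)
Let pickle_index n : 'rV[R]_d -> nat := pickle \o cell_index n.

Let measurable_pickle_index n k : measurable (pickle_index n @^-1` [set k]).
Proof.
have [[x xk]|nk] := pselect (exists x, pickle_index n x = k).
  rewrite (_ : _ @^-1` _ = cell_index n @^-1` [set cell_index n x]).
    exact: measurable_cell.
  apply/seteqP; split=> y /=; rewrite -xk /pickle_index /=.
    exact: (pcan_inj pickleK).
  by move=> ->.
rewrite (_ : _ @^-1` _ = set0) // -subset0 => y yk; apply: nk; by exists y.
Qed.

(** The terms free of [eta] cancel: [(1 - t) * t ^+ 2 + t * (1 - t) ^+ 2 = t * (1 - t)]. All that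
    remains carries a factor [eta]. *)
Let midpoint_defect_le (t eta W : R) :
  0 <= t -> t <= 1 -> 0 < eta -> eta <= 1 ->
  (1 - t) * ((t * W) ^+ 2 + eta) +
    t * (1 + eta) * (((1 - t) * W) ^+ 2 + eta) + t * (eta ^+ 2 + eta)
    - t * (1 - t) * W ^+ 2 <= eta * (5 + W ^+ 2).
Proof.
move=> t0 t1 eta0 eta1.
have t1' : 0 <= 1 - t by rewrite subr_ge0.
have tt : t * (1 - t) ^+ 2 <= 1.
  by rewrite -[leRHS]mulr1 ler_pM// ?sqr_ge0// expr_le1 // lerBlDr lerDl.
have teta : t * eta <= 1 by rewrite -[leRHS]mulr1 ler_pM// ltW.
rewrite -subr_ge0 (_ : _ - _ = eta * (4 - 2 * (t * eta) - t) +
  eta * W ^+ 2 * (1 - t * (1 - t) ^+ 2)); last by ring.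
rewrite addr_ge0// mulr_ge0 ?subr_ge0//; [exact: ltW|by lra|].
by rewrite mulr_ge0 ?sqr_ge0// ltW.
Qed.

(* An optimal plan through [nu] would make [Z] a convex combination of [X] and
   [Y]; nearly optimal plans, glued only up to small cells, make it nearly so. *)
Lemma approximate_midpoint (mu0 mu1 nu : P2 R d) (t eta W : R) :
    0 <= t -> t <= 1 -> 0 < eta -> eta <= 1 ->
    W2 mu0 nu = t * W -> W2 nu mu1 = (1 - t) * W -> W2 mu0 mu1 = W ->
  exists (P : probability
      (('rV[R]_d * 'rV[R]_d) * ('rV[R]_d * 'rV[R]_d))%type R)
    X Y Z,
  [/\ [/\ square_integrable P X, square_integrable P Y & square_integrable P Z],
      [/\ forall A, measurable A -> P (X @^-1` A) = mu0 A,
          forall A, measurable A -> P (Y @^-1` A) = mu1 A &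
          forall A, measurable A -> P (Z @^-1` A) = nu A],
      W ^+ 2 <= \int[P]_w enorm (X w - Y w) ^+ 2 &
      \int[P]_w enorm (Z w - ((1 - t) *: X w + t *: Y w)) ^+ 2
        <= eta * (5 + W ^+ 2)].
Proof.
move=> t0 t1 eta0 eta1 W0 W1 W01.
have [g1 cg1 g1W] := W2_approx mu0 nu eta0.
have [g2 cg2 g2W] := W2_approx nu mu1 eta0.
(* The level is chosen so that two points of one cell lie within Euclidean distance [eta]. *)
have [N Nd] : exists N : nat, d%:R * N.+1%:R^-1 ^+ 2 <= eta ^+ 2.
  have eta20 : 0 < eta ^+ 2 by rewrite exprn_gt0.
  pose N := Num.truncn (d%:R / eta ^+ 2); exists N.
  have dN : d%:R / eta ^+ 2 < N.+1%:R by rewrite truncnS_gt// divr_ge0// ltW.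
  apply: (@le_trans _ _ (d%:R * N.+1%:R^-1)).
    by rewrite ler_wpM2l// expr2 ler_piMl// invf_le1// ler1n.
  by rewrite ler_pdivrMr// mulrC -ler_pdivrMr// ltW.
have [P [P1 P2 Pidx]] : exists P : probability _ R,
    [/\ forall E, measurable E -> P (fst @^-1` E) = g1 E,
        forall E, measurable E -> P (snd @^-1` E) = g2 E &
        {ae P, forall p, pickle_index N p.1.2 = pickle_index N p.2.1}].
  apply: approximate_gluing => // B mB.
  have [_ e1] := cg1 _ mB; have [e2 _] := cg2 _ mB.
  exact: etrans e1 (esym e2).
(* [Z] and [Z'] are the two copies of the middle point: both have law [nu] and they almost surely
   share a cell. *)
pose X (w : ('rV[R]_d * 'rV[R]_d) * ('rV[R]_d * 'rV[R]_d)) := w.1.1.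
pose Z (w : ('rV[R]_d * 'rV[R]_d) * ('rV[R]_d * 'rV[R]_d)) := w.1.2.
pose Z' (w : ('rV[R]_d * 'rV[R]_d) * ('rV[R]_d * 'rV[R]_d)) := w.2.1.
pose Y (w : ('rV[R]_d * 'rV[R]_d) * ('rV[R]_d * 'rV[R]_d)) := w.2.2.
have mX : measurable_fun setT X by apply: measurableT_comp.
have mZ : measurable_fun setT Z by apply: measurableT_comp.
have mZ' : measurable_fun setT Z' by apply: measurableT_comp.
have mY : measurable_fun setT Y by apply: measurableT_comp.
have lX A : measurable A -> P (X @^-1` A) = mu0 A.
  move=> mA; have [<- _] := cg1 _ mA; rewrite -[RHS]P1//.
  by rewrite -[X in measurable X]setTI; exact: measurable_fst.
have lZ A : measurable A -> P (Z @^-1` A) = nu A.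
  move=> mA; have [_ <-] := cg1 _ mA; rewrite -[RHS]P1//.
  by rewrite -[X in measurable X]setTI; exact: measurable_snd.
have lZ' A : measurable A -> P (Z' @^-1` A) = nu A.
  move=> mA; have [<- _] := cg2 _ mA; rewrite -[RHS]P2//.
  by rewrite -[X in measurable X]setTI; exact: measurable_fst.
have lY A : measurable A -> P (Y @^-1` A) = mu1 A.
  move=> mA; have [_ <-] := cg2 _ mA; rewrite -[RHS]P2//.
  by rewrite -[X in measurable X]setTI; exact: measurable_snd.
have sX : square_integrable P X.
  exact: (square_integrable_law mX lX (square_integrable_P2 mu0)).
have sZ : square_integrable P Z.
  exact: (square_integrable_law mZ lZ (square_integrable_P2 nu)).
have sZ' : square_integrable P Z'.
  exact: (square_integrable_law mZ' lZ' (square_integrable_P2 nu)).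
have sY : square_integrable P Y.
  exact: (square_integrable_law mY lY (square_integrable_P2 mu1)).
have [_ iXZ] := square_integrableB sX sZ.
have [_ iZY] := square_integrableB sZ' sY.
have [_ iXY] := square_integrableB sX sY.
have [_ iZZ] := square_integrableB sZ sZ'.
have [mZW iZW] :
    square_integrable P (fun w => Z w - ((1 - t) *: X w + t *: Y w)).
  apply: square_integrableB => //; apply: square_integrableD;
    exact: square_integrableZ.
have eXZ : \int[P]_w enorm (X w - Z w) ^+ 2 <= (t * W) ^+ 2 + eta.
  rewrite -W0; apply: le_trans g1W.
  rewrite -(@Rintegral_law _ _ _ _ _ P g1 fst)//.
  by have [] := coupling_square_integrable cg1.
have eZY : \int[P]_w enorm (Z' w - Y w) ^+ 2 <= ((1 - t) * W) ^+ 2 + eta.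
  rewrite -W1; apply: le_trans g2W.
  rewrite -(@Rintegral_law _ _ _ _ _ P g2 snd)//.
  by have [] := coupling_square_integrable cg2.
have eZZ : \int[P]_w enorm (Z w - Z' w) ^+ 2 <= eta ^+ 2.
  rewrite -lee_fin EFin_Rintegral// -(Rintegral_cst1 P (eta ^+ 2)).
  rewrite EFin_Rintegral; last exact: Rintegrable_cst.
  apply: ae_ge0_le_integral => //.
  - by move=> w _; rewrite lee_fin enorm2_ge0.
  - exact: (measurable_int _ iZZ).
  - by move=> w _; rewrite lee_fin sqr_ge0.
  apply: filterS Pidx => w /= /(pcan_inj pickleK) ww _; rewrite lee_fin.
  apply: le_trans Nd; rewrite enorm2E.
  apply: (@le_trans _ _ (\sum_(i < d) N.+1%:R^-1 ^+ 2)); last first.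
    by rewrite sumr_const card_ord mulr_natl.
  apply: ler_sum => i _; rewrite !mxE -real_normK ?num_real//.
  by rewrite ler_sqr ?nnegrE// ltW//; exact: cell_index_close.
(* The joint law of [X] and [Y] is some coupling of the endpoints, so its cost is at least [W ^+ 2];
   this enters the final estimate with a minus sign. *)
have eXY : W ^+ 2 <= \int[P]_w enorm (X w - Y w) ^+ 2.
  have mXY : measurable_fun setT (fun w => (X w, Y w)).
    exact: (measurable_fun_pair mX mY).
  pose XY : {mfun _ >-> _} := HB.pack (fun w => (X w, Y w))
    (isMeasurableFun.Build _ _ _ _ _ mXY).
  have cXY : coupling mu0 mu1 (distribution P XY).
    by move=> A mA; split; [exact: lX|exact: lY].
  rewrite -W01; apply: le_trans (W2_le_cost cXY) _.
  rewrite -(@Rintegral_law _ _ _ _ _ P (distribution P XY) XY)//.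
  by have [] := coupling_square_integrable cXY.
exists P, X, Y, Z; split=> //.
(* Replacing [Z] by [Z'] in the distance to [Y] uses Young's inequality with parameter [eta]. The
   large factor [c] multiplies a quantity of size [eta ^+ 2], so the product is still of order
   [eta]. *)
pose c := (1 + eta^-1).
have pw w : enorm (Z w - ((1 - t) *: X w + t *: Y w)) ^+ 2 <=
    (1 - t) * enorm (X w - Z w) ^+ 2 + (t * (1 + eta)) * enorm (Z' w - Y w) ^+ 2
    + (t * c) * enorm (Z w - Z' w) ^+ 2
    - (t * (1 - t)) * enorm (X w - Y w) ^+ 2.
  rewrite enorm2_segment lerD2r -addrA lerD2l -!mulrA -mulrDr ler_wpM2l//.
  have -> : Z w - Y w = Z' w - Y w + (Z w - Z' w).
    by rewrite [RHS]addrC addrA subrK.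
  exact: enorm2_add_le.
have i1 := RintegrableZ (1 - t) iXZ.
have i2 := RintegrableZ (t * (1 + eta)) iZY.
have i3 := RintegrableZ (t * c) iZZ.
have i4 := RintegrableZ (t * (1 - t)) iXY.
have i12 := RintegrableD i1 i2.
have i123 := RintegrableD i12 i3.
have i1234 := RintegrableB i123 i4.
apply: le_trans (le_Rintegral measurableT iZW i1234 (fun w _ => pw w)) _.
rewrite (RintegralB _ i123 i4)// (RintegralD _ i12 i3)// (RintegralD _ i1 i2)//.
rewrite !RintegralZl//.
have t1' : 0 <= 1 - t by rewrite subr_ge0.
have c0 : 0 <= c by rewrite addr_ge0// invr_ge0 ltW.
have h1 := ler_wpM2l t1' eXZ.
have h2 := ler_wpM2l (mulr_ge0 t0 (addr_ge0 ler01 (ltW eta0))) eZY.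
have h3 := ler_wpM2l (mulr_ge0 t0 c0) eZZ.
have h4 := ler_wpM2l (mulr_ge0 t0 t1') eXY.
apply: le_trans (lerB (lerD (lerD h1 h2) h3) h4) _.
have -> : t * c * eta ^+ 2 = t * (eta ^+ 2 + eta).
  by rewrite /c; field; rewrite gt_eqF.
exact: midpoint_defect_le.
Qed.

End approximate_midpoint.

(** * Energy and semiconvexity inequalities for random variables *)

Lemma square_integrable_product (R : realType) n d1 d2
    (T1 : measurableType d1) (T2 : measurableType d2)
    (P : probability T1 R) (Q : probability T2 R)
    (X : T1 -> 'rV[R]_n) (Y : T2 -> 'rV[R]_n) :
  square_integrable P X -> square_integrable Q Y ->
  square_integrable (P \x Q)%E (fun w => X w.1 - Y w.2).
Proof.
move=> sX sY; apply: square_integrableB.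
- exact: (square_integrable_law measurable_fst (product_fst P Q) sX).
- exact: (square_integrable_law measurable_snd (product_snd P Q) sY).
Qed.

Section energy_law.
Context {R : realType} {n : nat} d (T : measurableType d).
Variables (P : probability T R) (mu : P2 R n) (Z : T -> 'rV[R]_n).
Hypothesis sZ : square_integrable P Z.
Hypothesis lawZ : forall A, measurable A -> P (Z @^-1` A) = mu A.
Variables (phi1 phi : 'rV[R]_n -> R) (C1 C : R).
Hypothesis cphi1 : continuous phi1.
Hypothesis phi1C : forall x, `|phi1 x| <= C1 * (1 + enorm x ^+ 2).
Hypothesis cphi : continuous phi.
Hypothesis phiC : forall x, `|phi x| <= C * (1 + enorm x ^+ 2).

Let Rintegral_potential : \int[mu]_q phi q = \int[P]_w phi (Z w).
Proof.
symmetry; apply: (Rintegral_law sZ.1 lawZ).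
exact: (Rintegrable_growth cphi phiC (square_integrable_P2 mu)).
Qed.

Let smu := square_integrable_P2 mu.

Let translate_Rintegrable q : Rintegrable P (fun w => phi1 (q - Z w)).
Proof.
apply: (Rintegrable_growth cphi1 phi1C).
apply: square_integrableB sZ; split; first exact: measurable_cst.
exact: Rintegrable_cst.
Qed.

Let convolveE q : convolve phi1 mu q = \int[P]_w phi1 (q - Z w).
Proof.
symmetry; apply: (Rintegral_law sZ.1 lawZ (f := fun y => phi1 (q - y))).
apply: (Rintegrable_growth cphi1 phi1C).
apply: square_integrableB smu; split; first exact: measurable_cst.
exact: Rintegrable_cst.
Qed.

Let EFin_convolve q :
  (convolve phi1 mu q)%:E = (\int[P]_w (phi1 (q - Z w))%:E)%E.
Proof. by rewrite convolveE EFin_Rintegral. Qed.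

Let interaction_muP :
  Rintegrable (mu \x P)%E (fun w => phi1 (w.1 - Z w.2)).
Proof.
exact: (Rintegrable_growth cphi1 phi1C (square_integrable_product smu sZ)).
Qed.

Let interaction_PP :
  Rintegrable (P \x P)%E (fun w => phi1 (Z w.1 - Z w.2)).
Proof.
exact: (Rintegrable_growth cphi1 phi1C (square_integrable_product sZ sZ)).
Qed.

(** Fubini on [mu \x P] yields both the measurability and the integrability of the convolution. *)
Let convolve_Rintegrable : Rintegrable mu (convolve phi1 mu).
Proof.
have := integrable_fubini_F interaction_muP.
by apply: eq_integrable => // q _; rewrite /fubini_F/= EFin_convolve.
Qed.

Let Rintegral_interaction : \int[mu]_q convolve phi1 mu q =
  \int[(P \x P)%E]_w phi1 (Z w.1 - Z w.2).
Proof.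
rewrite -(Rintegral_law sZ.1 lawZ convolve_Rintegrable); congr fine.
rewrite -(integral12_prod_meas1 interaction_PP).
by apply: eq_integral => w _; rewrite EFin_convolve.
Qed.

(** The interaction term becomes an expectation over two independent copies of [Z]: the inner and
    outer integrals are transported to [P] in turn, then joined by Fubini. *)
Lemma energy_law : energy phi1 phi mu =
  1 / 2 * (\int[(P \x P)%E]_w phi1 (Z w.1 - Z w.2)) + \int[P]_w phi (Z w).
Proof. by rewrite /energy Rintegral_interaction Rintegral_potential. Qed.

End energy_law.

(** [K] is chosen before the probability space, so the same inequality serves on [P] for the
    potential and on [P \x P] for the interaction. *)
Lemma Rintegral_semiconvex_le (R : realType) n (f : 'rV[R]_n -> R) (l C : R) :
    semiconvex l f -> continuous f ->
    (forall x, `|f x| <= C * (1 + enorm x ^+ 2)) ->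
  exists2 K, 0 <= K & forall d (T : measurableType d) (P : probability T R)
    (X Y Z : T -> 'rV[R]_n) (s t : R),
    square_integrable P X -> square_integrable P Y -> square_integrable P Z ->
    0 < s -> s <= 1 -> 0 <= t -> t <= 1 ->
    \int[P]_w f (Z w) <= (1 - t) * (\int[P]_w f (X w)) + t * (\int[P]_w f (Y w))
      - l / 2 * (t * (1 - t) * \int[P]_w enorm (X w - Y w) ^+ 2)
      + K * (s * (1 + \int[P]_w enorm (X w) ^+ 2 + \int[P]_w enorm (Y w) ^+ 2)
        + s^-1 * \int[P]_w enorm (Z w - ((1 - t) *: X w + t *: Y w)) ^+ 2).
Proof.
move=> f_cvx cf fC; have [K K0 pw] := semiconvex_perturbation f_cvx fC.
exists K => // d T P X Y Z s t sX sY sZ s0 s1 t0 t1.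
have fX := Rintegrable_growth cf fC sX.
have fY := Rintegrable_growth cf fC sY.
have fZ := Rintegrable_growth cf fC sZ.
have [_ iXY] := square_integrableB sX sY.
have sW := square_integrableD (square_integrableZ (1 - t) sX)
  (square_integrableZ t sY).
have [_ iZW] := square_integrableB sZ sW.
have i1 := RintegrableZ (1 - t) fX.
have i2 := RintegrableZ t fY.
have i12 := RintegrableD i1 i2.
have i3' := RintegrableZ (t * (1 - t)) iXY.
have i3 := RintegrableZ (l / 2) i3'.
have i123 := RintegrableB i12 i3.
have i4' := RintegrableD (Rintegrable_cst P 1) sX.2.
have i4'' := RintegrableD i4' sY.2.
have i4 := RintegrableZ s i4''.
have i5 := RintegrableZ s^-1 iZW.
have i45 := RintegrableD i4 i5.
have i6 := RintegrableZ K i45.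
have i := RintegrableD i123 i6.
apply: le_trans (le_Rintegral measurableT fZ i
  (fun w _ => pw s t (X w) (Y w) (Z w) s0 s1 t0 t1)) _.
rewrite (RintegralD _ i123 i6)// (RintegralB _ i12 i3)// (RintegralD _ i1 i2)//.
rewrite (RintegralZl _ _ fX)// (RintegralZl _ _ fY)// (RintegralZl _ _ i3')//.
rewrite (RintegralZl _ _ iXY)// (RintegralZl _ _ i45)// (RintegralD _ i4 i5)//.
rewrite (RintegralZl _ _ iZW)// (RintegralZl _ _ i4'')//.
by rewrite (RintegralD _ i4' sY.2)// (RintegralD _ (Rintegrable_cst P 1) sX.2)//
  Rintegral_cst1.
Qed.

Lemma Rintegral_product_sub_le (R : realType) n d (T : measurableType d)
    (P : probability T R) (U : T -> 'rV[R]_n) : square_integrable P U ->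
  \int[(P \x P)%E]_w enorm (U w.1 - U w.2) ^+ 2 <=
    4 * \int[P]_w enorm (U w) ^+ 2.
Proof.
move=> sU; have [_ iU] := square_integrable_product sU sU.
have i1 := Rintegrable_law measurable_fst (product_fst P P) sU.2.
have i2 := Rintegrable_law measurable_snd (product_snd P P) sU.2.
have e1 := Rintegral_law measurable_fst (product_fst P P) sU.2.
have e2 := Rintegral_law measurable_snd (product_snd P P) sU.2.
have j1 := RintegrableZ 2 i1; have j2 := RintegrableZ 2 i2.
apply: le_trans (le_Rintegral measurableT iU (RintegrableD j1 j2)
  (fun w _ => enorm2_sub (U w.1) (U w.2))) _.
rewrite (RintegralD _ j1 j2)// (RintegralZl _ _ i1)// (RintegralZl _ _ i2)//.
rewrite {1}e1 e2; lra.
Qed.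

(** Primed letters and [a] stand for integrals over the product space, each at most 4 times its
    counterpart. With the prefactor [1 / 2], the quadratic loss [lambda1 / 2 * (T * a)] contributes
    at most [|lambda1| * (T * b)], which turns [lambda] into [lambda - 2 * |lambda1|]. *)
Lemma energy_bound_arith (R : realType)
    (lambda lambda1 T t K K1 s a b e e' x x' y y' z1 z px1 px py1 py : R) :
  0 <= T -> 0 <= K1 -> 0 < s -> a <= 4 * b -> 0 <= a -> e' <= 4 * e ->
  x' <= 4 * x -> y' <= 4 * y ->
  z1 <= (1 - t) * px1 + t * py1 - lambda1 / 2 * (T * a)
    + K1 * (s * (1 + x' + y') + s^-1 * e') ->
  z <= (1 - t) * px + t * py - lambda / 2 * (T * b)
    + K * (s * (1 + x + y) + s^-1 * e) ->
  1 / 2 * z1 + z <= (1 - t) * (1 / 2 * px1 + px) + t * (1 / 2 * py1 + py)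
    - (lambda - 2 * `|lambda1|) / 2 * (T * b)
    + (K + 2 * K1) * (s * (1 + x + y) + s^-1 * e).
Proof.
move=> T0 K10 s0 ab a0 ee xx yy h1 h2.
have si0 : 0 < s^-1 by rewrite invr_gt0.
have h3 : - (lambda1 * (T * a)) <= `|lambda1| * (T * (4 * b)).
  apply: (@le_trans _ _ (`|lambda1| * (T * a))).
    by rewrite -mulNr ler_wpM2r ?mulr_ge0// -normrN ler_norm.
  by rewrite ler_wpM2l// ler_wpM2l.
have h4 : K1 * (s * (1 + x' + y') + s^-1 * e') <=
    K1 * (4 * (s * (1 + x + y) + s^-1 * e)).
  rewrite ler_wpM2l// [leRHS]mulrDr lerD//.
    rewrite [leRHS]mulrCA ler_wpM2l//; first exact: ltW.
    by lra.
  by rewrite [leRHS]mulrCA ler_wpM2l// ltW.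
move: h4 h1 h2 h3.
move: (s * (1 + x' + y') + s^-1 * e') (s * (1 + x + y) + s^-1 * e).
move=> A B h4 h1 h2 h3.
lra.
Qed.

(** * Displacement convexity of the energy *)

Section displacement.
Context {R : realType} {d : nat}.
Variables (phi1 phi : 'rV[R]_d -> R) (lambda lambda1 C1 C : R).
Hypothesis cphi1 : continuous phi1.
Hypothesis phi1C : forall x, `|phi1 x| <= C1 * (1 + enorm x ^+ 2).
Hypothesis cphi : continuous phi.
Hypothesis phiC : forall x, `|phi x| <= C * (1 + enorm x ^+ 2).
Hypothesis phi_cvx : semiconvex lambda phi.
Hypothesis phi1_cvx : semiconvex lambda1 phi1.

Let kappa := lambda - 2 * `|lambda1|.

Lemma energy_perturbation : exists2 K, 0 <= K &
  forall d' (T : measurableType d') (P : probability T R)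
    (X Y Z : T -> 'rV[R]_d) (mu0 mu1 nu : P2 R d) (s t : R),
    square_integrable P X -> square_integrable P Y -> square_integrable P Z ->
    (forall A, measurable A -> P (X @^-1` A) = mu0 A) ->
    (forall A, measurable A -> P (Y @^-1` A) = mu1 A) ->
    (forall A, measurable A -> P (Z @^-1` A) = nu A) ->
    0 < s -> s <= 1 -> 0 <= t -> t <= 1 ->
    energy phi1 phi nu <=
      (1 - t) * energy phi1 phi mu0 + t * energy phi1 phi mu1
      - kappa / 2 * (t * (1 - t) * \int[P]_w enorm (X w - Y w) ^+ 2)
      + K * (s * (1 + \int[P]_w enorm (X w) ^+ 2 + \int[P]_w enorm (Y w) ^+ 2)
        + s^-1 * \int[P]_w enorm (Z w - ((1 - t) *: X w + t *: Y w)) ^+ 2).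
Proof.
have [K K0 phiK] := Rintegral_semiconvex_le phi_cvx cphi phiC.
have [K1 K10 phi1K] := Rintegral_semiconvex_le phi1_cvx cphi1 phi1C.
exists (K + 2 * K1); first by rewrite addr_ge0// mulr_ge0.
move=> d' T P X Y Z mu0 mu1 nu s t sX sY sZ lX lY lZ s0 s1 t0 t1.
rewrite (energy_law sZ lZ cphi1 phi1C cphi phiC).
rewrite (energy_law sX lX cphi1 phi1C cphi phiC).
rewrite (energy_law sY lY cphi1 phi1C cphi phiC).
have := phiK _ _ P X Y Z s t sX sY sZ s0 s1 t0 t1.
have := phi1K _ _ (P \x P)%E _ _ _ s t (square_integrable_product sX sX)
  (square_integrable_product sY sY) (square_integrable_product sZ sZ)
  s0 s1 t0 t1.
have sU := square_integrableB sX sY.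
have sW := square_integrableD (square_integrableZ (1 - t) sX)
  (square_integrableZ t sY).
have sV := square_integrableB sZ sW.
(* The difference of differences is regrouped as [U - U'] with [U = X - Y] and [U'] its independent
   copy; [DV] does the same with the interpolation defect. *)
have DU : \int[(P \x P)%E]_w enorm (X w.1 - X w.2 - (Y w.1 - Y w.2)) ^+ 2 <=
    4 * \int[P]_w enorm (X w - Y w) ^+ 2.
  apply: le_trans (Rintegral_product_sub_le sU).
  rewrite le_eqVlt; apply/orP; left; apply/eqP; apply: eq_Rintegral => w _.
  by congr (enorm _ ^+ 2); apply/rowP => i; rewrite !mxE; ring.
have DV : \int[(P \x P)%E]_w enorm (Z w.1 - Z w.2 -
      ((1 - t) *: (X w.1 - X w.2) + t *: (Y w.1 - Y w.2))) ^+ 2 <=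
    4 * \int[P]_w enorm (Z w - ((1 - t) *: X w + t *: Y w)) ^+ 2.
  apply: le_trans (Rintegral_product_sub_le sV).
  rewrite le_eqVlt; apply/orP; left; apply/eqP; apply: eq_Rintegral => w _.
  by congr (enorm _ ^+ 2); apply/rowP => i; rewrite !mxE; ring.
have DX := Rintegral_product_sub_le sX.
have DY := Rintegral_product_sub_le sY.
have DU0 : 0 <= \int[(P \x P)%E]_w enorm (X w.1 - X w.2 - (Y w.1 - Y w.2)) ^+ 2.
  by apply: Rintegral_ge0 => w _; exact: enorm2_ge0.
move: DU DV DX DY DU0.
move: (\int[(P \x P)%E]_w enorm (X w.1 - X w.2 - _) ^+ 2)
  (\int[(P \x P)%E]_w enorm (Z w.1 - Z w.2 - _) ^+ 2)
  (\int[(P \x P)%E]_w enorm (X w.1 - X w.2) ^+ 2)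
  (\int[(P \x P)%E]_w enorm (Y w.1 - Y w.2) ^+ 2)
  (\int[P]_w enorm (X w - Y w) ^+ 2)
  (\int[P]_w enorm (Z w - _) ^+ 2)
  (\int[P]_w enorm (X w) ^+ 2)
  (\int[P]_w enorm (Y w) ^+ 2).
move: (\int[(P \x P)%E]_w phi1 (Z w.1 - Z w.2))
  (\int[(P \x P)%E]_w phi1 (X w.1 - X w.2))
  (\int[(P \x P)%E]_w phi1 (Y w.1 - Y w.2))
  (\int[P]_w phi (Z w)) (\int[P]_w phi (X w)) (\int[P]_w phi (Y w)).
move=> pz1 px1 py1 pz px py a e x' y' b e' x y ab ee xx yy a0 h1 h2.
have T0 : 0 <= t * (1 - t) by rewrite mulr_ge0// subr_ge0.
exact: (energy_bound_arith T0 K10 s0 ab a0 ee xx yy h1 h2).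
Qed.

Lemma energy_displacement_convex :
  0 < kappa -> displacement_convex kappa (energy phi1 phi).
Proof.
move=> kappa_gt0 mu geo t.
set W := W2 _ _; set mu0 := mu 0%:i01; set mu1 := mu 1%:i01.
have t0 : 0 <= t%:num by [].
have t1 : t%:num <= 1 by [].
have W0t : W2 mu0 (mu t) = t%:num * W.
  by rewrite geo /= sub0r normrN ger0_norm.
have Wt1 : W2 (mu t) mu1 = (1 - t%:num) * W.
  by rewrite geo /= -normrN opprB ger0_norm// subr_ge0.
have [K K0 HK] := energy_perturbation.
pose m0 := \int[mu0]_x enorm x ^+ 2.
pose m1 := \int[mu1]_x enorm x ^+ 2.
(* [M] collects the error after division by [s]: with [eta = s ^+ 2] the defect is at most
   [s ^+ 2 * (5 + W ^+ 2)], and the factor [s^-1] leaves a single [s]. *)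
pose M := K * (1 + m0 + m1 + (5 + W ^+ 2)).
have m00 : 0 <= m0 by apply: Rintegral_ge0 => w _; exact: enorm2_ge0.
have m10 : 0 <= m1 by apply: Rintegral_ge0 => w _; exact: enorm2_ge0.
have M0 : 0 <= M.
  by rewrite mulr_ge0// !addr_ge0// sqr_ge0.
suff H s : 0 < s -> s <= 1 -> energy phi1 phi (mu t) <=
    (1 - t%:num) * energy phi1 phi mu0 + t%:num * energy phi1 phi mu1
    - kappa / 2 * t%:num * (1 - t%:num) * W ^+ 2 + s * M.
  apply/ler_addgt0Pr => e e0.
  (* Adding 1 to [M] keeps the denominator positive when [M = 0]. *)
  pose s := Num.min 1 (e / (M + 1)).
  have M1 : 0 < M + 1 by rewrite ltr_wpDl.
  have s0 : 0 < s by rewrite lt_min ltr01 divr_gt0.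
  apply: le_trans (H s s0 _) _; first by rewrite ge_min lexx.
  rewrite lerD2l; apply: (@le_trans _ _ (s * (M + 1))).
    by rewrite ler_wpM2l ?(ltW s0)// lerDl.
  by rewrite -ler_pdivlMr// ge_min lexx orbT.
move=> s0 s1.
have ss0 : 0 < s ^+ 2 by rewrite exprn_gt0.
have ss1 : s ^+ 2 <= 1 by rewrite exprn_ile1// ltW.
have [P [X [Y [Z [[sX sY sZ] [lX lY lZ] XY ZW]]]]] :=
  approximate_midpoint t0 t1 ss0 ss1 W0t Wt1 (erefl W).
apply: le_trans (HK _ _ P X Y Z mu0 mu1 (mu t) s t%:num
  sX sY sZ lX lY lZ s0 s1 t0 t1) _.
rewrite (Rintegral_law sX.1 lX (f := fun x => enorm x ^+ 2))//; last first.
  by have [] := square_integrable_P2 mu0.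
rewrite (Rintegral_law sY.1 lY (f := fun x => enorm x ^+ 2))//; last first.
  by have [] := square_integrable_P2 mu1.
rewrite -/m0 -/m1; apply: lerD.
  (* The cost of [(X, Y)] is only bounded below by [W ^+ 2], so the sign of [kappa] matters here. *)
  rewrite lerD2l lerN2 -!mulrA ler_wpM2l ?(ltW kappa_gt0)//.
  rewrite ler_wpM2l ?invr_ge0//.
  by rewrite ler_wpM2l// ler_wpM2l// subr_ge0.
rewrite /M [leRHS]mulrCA ler_wpM2l// [leRHS]mulrDr lerD2l.
rewrite ler_pdivrMl// mulrA -expr2; exact: ZW.
Qed.

End displacement.

(** * Integrals against mixtures and Dirac masses *)

Section mixture_integral.
Context {R : realType} {d : nat}.
Variables (t : {i01 R}) (mu0 mu1 : P2 R d) (f : 'rV[R]_d -> R).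
Hypotheses (f0 : Rintegrable mu0 f) (f1 : Rintegrable mu1 f).

Let ge0_integral_mixture (g : 'rV[R]_d -> \bar R) : measurable_fun setT g ->
  (forall x, 0 <= g x)%E ->
  (\int[P2_mixture t mu0 mu1]_x g x =
    (1 - t%:num)%:E * (\int[mu0]_x g x) + t%:num%:E * (\int[mu1]_x g x))%E.
Proof.
move=> mg g0; rewrite /= /mixture ge0_integral_measure_add//.
by rewrite !ge0_integral_mscale.
Qed.

Lemma Rintegrable_mixture : Rintegrable (P2_mixture t mu0 mu1) f.
Proof.
have [mf i0] := elimT (integrableP _ _ _) f0.
have [_ i1] := elimT (integrableP _ _ _) f1.
apply: (introT (integrableP _ _ _)); split=> //.
rewrite ge0_integral_mixture//; last exact: measurableT_comp.
by apply: lte_add_pinfty; apply: lte_mul_pinfty.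
Qed.

Lemma Rintegral_mixture : \int[P2_mixture t mu0 mu1]_x f x =
  (1 - t%:num) * (\int[mu0]_x f x) + t%:num * (\int[mu1]_x f x).
Proof.
have mf := measurable_int _ f0.
rewrite /Rintegral integralE (integralE mu0) (integralE mu1).
(* Mixing is known for nonnegative integrands only, so it is applied to the positive and negative
   parts, whose integrals are finite. *)
rewrite !ge0_integral_mixture//;
  [|exact: measurable_funeneg|exact: measurable_funepos].
have /fineK <- := integrable_pos_fin_num measurableT f0.
have /fineK <- := integrable_neg_fin_num measurableT f0.
have /fineK <- := integrable_pos_fin_num measurableT f1.
have /fineK <- := integrable_neg_fin_num measurableT f1.
by rewrite -!EFinM -!EFinD /=; ring.
Qed.

End mixture_integral.

Section dirac.
Context {R : realType} {d : nat}.

Lemma dirac_moment (a : 'rV[R]_d) :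
  finite_second_moment (dirac a : probability _ R).
Proof.
rewrite /finite_second_moment integral_dirac//; last exact: measurable_enorm2.
by rewrite diracT mul1e ltry.
Qed.

Definition P2_dirac (a : 'rV[R]_d) : P2 R d := MkP2 (dirac_moment a).

Lemma Rintegrable_P2_dirac (a : 'rV[R]_d) (f : 'rV[R]_d -> R) :
  measurable_fun setT f -> Rintegrable (P2_dirac a) f.
Proof.
move=> mf; apply: (introT (integrableP _ _ _)); split.
  exact/measurable_EFinP.
rewrite integral_dirac//; last by do 2 apply: measurableT_comp => //.
by rewrite diracT mul1e ltry.
Qed.

Lemma Rintegral_P2_dirac (a : 'rV[R]_d) (f : 'rV[R]_d -> R) :
  measurable_fun setT f -> \int[P2_dirac a]_x f x = f a.
Proof.
move=> mf; rewrite /Rintegral integral_dirac//; last exact/measurable_EFinP.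
by rewrite diracT mul1e.
Qed.

End dirac.

(** * Failure of classical convexity *)

Section classical_convexity.
Context {R : realType} {d : nat}.
Variables (phi1 phi : 'rV[R]_d -> R) (h : 'rV[R]_d).
Hypotheses (cphi1 : continuous phi1) (cphi : continuous phi).
Hypothesis phi1_even : forall x, phi1 (- x) = phi1 x.

Let half_ge0 : 0 <= 2^-1 :> R. Proof. by rewrite invr_ge0. Qed.
Let half_le1 : 2^-1 <= 1 :> R. Proof. by rewrite invf_le1// ler1n. Qed.
Let half : {i01 R} := Itv01 half_ge0 half_le1.

Let delta0 : P2 R d := P2_dirac 0.
Let pair := P2_mixture half (P2_dirac (- h)) (P2_dirac h).
Let triple := P2_mixture half pair delta0.

Implicit Types f : 'rV[R]_d -> R.

Let int_delta0 f : continuous f -> \int[delta0]_x f x = f 0.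
Proof. by move=> /continuous_measurable_rV; exact: Rintegral_P2_dirac. Qed.

Let int_pair f : continuous f -> \int[pair]_x f x = 2^-1 * f (- h) + 2^-1 * f h.
Proof.
move=> /continuous_measurable_rV mf.
rewrite Rintegral_mixture; try exact: Rintegrable_P2_dirac.
by rewrite !Rintegral_P2_dirac//=; congr (_ * _ + _); field.
Qed.

Let int_triple f : continuous f ->
  \int[triple]_x f x = 2^-1 * (2^-1 * f (- h) + 2^-1 * f h) + 2^-1 * f 0.
Proof.
move=> cf; have mf := continuous_measurable_rV cf.
rewrite Rintegral_mixture; last 2 first.
- by apply: Rintegrable_mixture; exact: Rintegrable_P2_dirac.
- exact: Rintegrable_P2_dirac.
by rewrite int_pair// int_delta0//=; congr (_ * _ + _); field.
Qed.

Let continuous_shift (a : 'rV[R]_d) :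
  continuous (fun q : 'rV[R]_d => phi1 (q - a)).
Proof.
move=> q; apply: (@continuous_comp _ _ _ (fun x : 'rV[R]_d => x - a) phi1 q).
  2: exact: cphi1.
apply: (@cvgB _ _ _ (nbhs q) _ (fun x : 'rV[R]_d => x) (fun=> a) q a).
  exact: cvg_id.
exact: cvg_cst.
Qed.

Let continuous_reflect (q : 'rV[R]_d) :
  continuous (fun y : 'rV[R]_d => phi1 (q - y)).
Proof.
move=> y; apply: (@continuous_comp _ _ _ (fun x : 'rV[R]_d => q - x) phi1 y).
  2: exact: cphi1.
apply: (@cvgB _ _ _ (nbhs y) _ (fun=> q) (fun x : 'rV[R]_d => x) q y).
  exact: cvg_cst.
exact: cvg_id.
Qed.

Let conv_delta0 : convolve phi1 delta0 = phi1.
Proof.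
by apply/funext => q; rewrite /convolve int_delta0 ?subr0//.
Qed.

Let conv_pair : convolve phi1 pair =
  fun q => 2^-1 * phi1 (q - - h) + 2^-1 * phi1 (q - h).
Proof. by apply/funext => q; rewrite /convolve int_pair. Qed.

Let conv_triple : convolve phi1 triple = fun q =>
  2^-1 * (2^-1 * phi1 (q - - h) + 2^-1 * phi1 (q - h)) + 2^-1 * phi1 q.
Proof. by apply/funext => q; rewrite /convolve int_triple// subr0. Qed.

Let continuous_scale (a : R) f :
  continuous f -> continuous (fun q : 'rV[R]_d => a * f q).
Proof.
move=> cf q; apply: (@cvgM _ _ (nbhs q) _ (fun=> a) f a (f q)); last exact: cf.
exact: cvg_cst.
Qed.

Let continuous_add f g : continuous f -> continuous g ->
  continuous (fun q : 'rV[R]_d => f q + g q).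
Proof.
by move=> cf cg q; apply: (@cvgD _ _ _ (nbhs q) _ f g); [exact: cf|exact: cg].
Qed.

(** With [u = phi1 (2 *: h)], the double integrals of [phi1] are [(1 + u) / 2] for [pair], 1 for
    [delta0] and [(7 + u) / 8] for their midpoint [triple]. The last exceeds the average of the
    first two by [(1 - u) / 8], while the potential term is affine under mixing and cancels. *)
Lemma energy_not_convex : phi1 0 = 1 -> phi1 h = 1 -> phi1 (2 *: h) < 1 ->
  ~ classically_convex (energy phi1 phi).
Proof.
move=> e0 eh e2h cvx; have := cvx pair delta0 half; rewrite -/triple /energy.
have cpair :
    continuous (fun q : 'rV[R]_d => 2^-1 * phi1 (q - - h) + 2^-1 * phi1 (q - h)).
  by apply: continuous_add; apply: continuous_scale.
rewrite conv_delta0 conv_pair conv_triple !int_delta0//.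
rewrite !int_pair// !int_triple//; last first.
  by apply: continuous_add; apply: continuous_scale.
rewrite !opprK !addNr !subrr !sub0r !add0r !phi1_even -!opprD !phi1_even.
have hh : h + h = 2 *: h by rewrite scaler_nat mulr2n.
rewrite hh e0 eh /=; move: e2h; move: (phi1 _) (phi _) (phi _) (phi _).
by move=> u a b c u1; lra.
Qed.

End classical_convexity.

(** * The test direction and the conclusion *)

Lemma enorm2_delta (R : realType) d (i : 'I_d) :
  enorm (delta_mx 0 i : 'rV[R]_d) ^+ 2 = 1.
Proof.
rewrite enorm2E (bigD1 i)//= big1 => [|j ji]; rewrite mxE !eqxx/=.
  by rewrite addr0 expr1n.
by rewrite (negbTE ji) expr0n.
Qed.

(** Vanishing is assumed only strictly outside the ball of radius 2, whereas the counterexample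
    evaluates [phi1] on the sphere; a limit from the right along the ray reaches that point. *)
Lemma continuous_eq0_on_ray (R : realType) d (f : 'rV[R]_d -> R) (h : 'rV[R]_d)
    (r : R) : {for r *: h, continuous f} ->
  (forall a, r < a -> f (a *: h) = 0) -> f (r *: h) = 0.
Proof.
move=> cf f0; apply: (@cvg_unique _ _ (f (a *: h) @[a --> r^'+])) => //=.
- have ch : a *: h @[a --> r^'+] --> r *: h.
    by apply: cvgZr_tmp; apply: cvg_at_right_filter; exact: cvg_id.
  exact: (cvg_comp _ _ ch cf).
- by apply: cvg_near_cst; apply: filterS (nbhs_right_gt r) => a /f0.
Qed.

Theorem lemmaB3 (R : realType) (d : nat) (d_gt0 : (0 < d)%N)
    (phi1 phi : 'rV[R]_d -> R) (lambda lambda1 : R)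
    (phi1_C2 : class_C2 phi1) (phi1_bnd : bounded_second_derivatives phi1)
    (phi_C2 : class_C2 phi) (phi_bnd : bounded_second_derivatives phi)
    (phi1_even : forall x, phi1 (- x) = phi1 x)
    (lambda_gt0 : 0 < lambda)
    (lambda1_itv : - (lambda / 2) < lambda1 < lambda / 2)
    (phi_cvx : semiconvex lambda phi)
    (phi1_cvx : semiconvex lambda1 phi1) :
  let V := energy phi1 phi in
  let kappa := lambda - 2 * `|lambda1| in
  [/\ 0 < kappa, displacement_convex kappa V & displacement_convex 0 V] /\
  ((forall x, 0 <= phi1 x) ->
   (forall x, enorm x <= 1 -> phi1 x = 1) ->
   (forall x, 2 < enorm x -> phi1 x = 0) ->
   ~ classically_convex V).
Proof.
move=> V kappa.
have [C1 _ phi1C] := quadratic_growth phi1_C2 phi1_bnd.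
have [C _ phiC] := quadratic_growth phi_C2 phi_bnd.
have cphi1 : continuous phi1 by case: phi1_C2.
have cphi : continuous phi by case: phi_C2.
have kappa_gt0 : 0 < kappa.
  rewrite /kappa subr_gt0 -ltr_pdivlMl// mulrC.
  by case/andP: lambda1_itv => l1 l2; rewrite ltr_norml l1 l2.
have Vcvx : displacement_convex kappa V.
  exact: (energy_displacement_convex cphi1 phi1C cphi phiC phi_cvx phi1_cvx).
split.
  split=> // mu geo t; apply: le_trans (Vcvx mu geo t) _.
  rewrite !mul0r subr0 lerBlDr lerDl mulr_ge0 ?sqr_ge0//.
  apply: mulr_ge0; last by rewrite subr_ge0.
  by apply: mulr_ge0 => //; rewrite divr_ge0// ltW.
move=> phi1_ge0 phi1_ball phi1_out.
(* A Euclidean unit vector exists because [d] is positive; 0 and [h] lie in the unit ball and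
   [2 *: h] on the sphere of radius 2. *)
pose h : 'rV[R]_d := delta_mx 0 (Ordinal d_gt0).
have enormZh a : 0 <= a -> enorm (a *: h) = a.
  move=> a0; rewrite -[LHS]ger0_norm ?sqrtr_ge0// -sqrtr_sqr enorm2Z.
  by rewrite enorm2_delta mulr1 sqrtr_sqr ger0_norm.
apply: (@energy_not_convex _ _ phi1 phi h) => //.
- by apply: phi1_ball; rewrite -(scale0r h) enormZh.
- by apply: phi1_ball; rewrite -(scale1r h) enormZh.
- rewrite (@continuous_eq0_on_ray _ _ phi1 h 2)//; first exact: cphi1.
  by move=> a a2; apply: phi1_out; rewrite enormZh// (le_trans _ (ltW a2)).
Qed.
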